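(* For every $n\ge 3$, \begin{align*} &N'(PO_n)=N(PO_n)=M(PO_n)=M'(PO_n)=n,\\ &N'(O_n)=N(O_n)=n-1,\\ &N'(POI_n)=N(POI_n)=M(POI_n)=M'(POI_n)=n. \end{align*}
   Context: $PT_n$ is the semigroup, under composition (functions act on the right), of all partial functions from $X_n=\{1,\dots,n\}$ to itself; $T_n$ is its subsemigroup of functions with domain $X_n$, and $I_n$ its subsemigroup of injective partial functions. $s\in PT_n$ is order preserving if for all $x,y$ in the domain of $s$, $x\le y$ implies $xs\le ys$. With $1$ denoting the identity map of $X_n$, $PO_n$, $O_n$ and $POI_n$ denote the semigroups of all order preserving elements of $PT_n\setminus\{1\}$, $T_n\setminus\{1\}$ and $I_n\setminus\{1\}$, respectively. A generating set of a finite semigroup $S$ is a non-empty subset $A\subseteq S$ such that every element of $S$ is a product of one or more elements of $A$; it is minimal if no proper subset is a generating set; $\mathrm{rank}(S)$ is the smallest cardinality of a generating set. For a generating set $A$ and $s\in S$, the length $l_A(s)$ is the least $k$ such that $s=a_1\cdots a_k$ with $a_i\in A$, except that the identity element of $S$ (if there is one) has length $0$ by convention. $\ker(S)$ is the minimum ideal of $S$ and $N(S,A)=\min\{l_A(s): s\in\ker(S)\}$. The depth parameters are: $N(S)$ and $M(S)$, respectively the minimum and the maximum of $N(S,A)$ over all generating sets $A$ with $|A|=\mathrm{rank}(S)$; $N'(S)$ and $M'(S)$, respectively the minimum and the maximum of $N(S,A)$ over all minimal generating sets $A$. *)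

(* Defs.v *)
From HB Require Import structures.
From mathcomp Require Import all_boot.
From mathcomp Require Import boolp.

Set Implicit Arguments.
Unset Strict Implicit.
Unset Printing Implicit Defensive.

Local Open Scope group_scope.

#[short(type="finMonoidType")]
HB.structure Definition FinMonoid := { G of Monoid G & Finite G }.

(* Minimum of a non-empty set of naturals (0 if the set is empty). *)
Definition least (P : pred nat) : nat :=
  if pselect (exists k, P k) is left exP then ex_minn exP else 0.

(* A finite semigroup is given as a subset S of a finite monoid T that is
   closed under multiplication.  The unit of T need not belong to S; it is
   only used as the value of the empty product, and no definition below
   allows products of length 0. *)
Section Semigroup.
Variable T : finMonoidType.
Implicit Types (S A I K : {set T}) (s e : T) (k : nat).

Definition products k A : {set T} :=
  [set \prod_(a <- w) a | w : k.-tuple T & all [in A] w].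

Definition generating S A : bool :=
  [&& A != set0, A \subset S &
      [forall s in S, `[< exists2 k, 0 < k & s \in products k A >]]].

Definition minimal_generating S A : bool := minset (generating S) A.

Definition rank S : nat :=
  least (fun k => [exists A : {set T}, generating S A && (#|A| == k)]).

Definition is_identity S e : bool :=
  (e \in S) && [forall s in S, (e * s == s) && (s * e == s)].

Definition word_length S A s : nat :=
  if is_identity S s then 0
  else least (fun k => (0 < k) && (s \in products k A)).

Definition ideal S I : bool :=
  [&& I != set0, I \subset S &
      [forall i in I, forall s in S, (i * s \in I) && (s * i \in I)]].

(* The minimum ideal: an ideal contained in every ideal. It is unique, so
   pick makes no choice. *)
Definition ker S : {set T} :=
  odflt set0
    [pick K : {set T} | ideal S K
                        && [forall I : {set T}, ideal S I ==> (K \subset I)]].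

(* N(S, A) *)
Definition depth S A : nat :=
  least (fun m => [exists s in ker S, word_length S A s == m]).

Definition param_N S : nat :=
  least (fun m => [exists A : {set T},
    [&& generating S A, #|A| == rank S & depth S A == m]]).

Definition param_M S : nat :=
  \max_(A : {set T} | generating S A && (#|A| == rank S)) depth S A.

Definition param_N' S : nat :=
  least (fun m => [exists A : {set T},
    minimal_generating S A && (depth S A == m)]).

Definition param_M' S : nat :=
  \max_(A : {set T} | minimal_generating S A) depth S A.

End Semigroup.

(* Partial self-maps of 'I_n = {0, ..., n-1}, standing for X_n = {1, ..., n};
   s x = None means that x is not in the domain of s. *)
Definition pfun (n : nat) : Type := {ffun 'I_n -> option 'I_n}.

HB.instance Definition _ n := Finite.on (pfun n).

Section PartialFunctions.
Variable n : nat.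
Implicit Types s t : pfun n.

(* Maps act on the right: x (s * t) = (x s) t. *)
Definition pfun_mul s t : pfun n := [ffun x => obind t (s x)].
Definition pfun_one : pfun n := [ffun x => Some x].

Fact pfun_mulA : associative pfun_mul.
Proof.
by move=> s t u; apply/ffunP => x; rewrite !ffunE; case: (s x) => //= y; rewrite ffunE.
Qed.

Fact pfun_mul1g : left_id pfun_one pfun_mul.
Proof. by move=> s; apply/ffunP => x; rewrite !ffunE. Qed.

Fact pfun_mulg1 : right_id pfun_one pfun_mul.
Proof.
by move=> s; apply/ffunP => x; rewrite !ffunE; case: (s x) => //= y; rewrite ffunE.
Qed.

HB.instance Definition _ :=
  isMonoid.Build (pfun n) pfun_mulA pfun_mul1g pfun_mulg1.

Definition total_pfun s : bool := [forall x, s x != None].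

Definition injective_pfun s : bool :=
  [forall x, forall y, (s x != None) && (s x == s y) ==> (x == y)].

Definition order_preserving s : bool :=
  [forall x, forall y, forall a, forall b,
    [&& s x == Some a, s y == Some b & x <= y] ==> (a <= b)].

End PartialFunctions.

Definition PT_sg n : {set pfun n} := [set: pfun n].
Definition T_sg n : {set pfun n} := [set s in PT_sg n | total_pfun s].
Definition I_sg n : {set pfun n} := [set s in PT_sg n | injective_pfun s].

Definition PO_sg n : {set pfun n} := [set s in PT_sg n :\ 1 | order_preserving s].
Definition O_sg n : {set pfun n} := [set s in T_sg n :\ 1 | order_preserving s].
Definition POI_sg n : {set pfun n} := [set s in I_sg n :\ 1 | order_preserving s].

(* Main.v *)
Require Import Defs.
From mathcomp Require Import all_boot boolp zify.

Set Implicit Arguments.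
Unset Strict Implicit.
Unset Printing Implicit Defensive.

Local Open Scope group_scope.

(** Multiplying by a map of rank at least n - 1 lowers the rank by at most one
    ([rk_mul_ge]).  In each of the three semigroups the elements of rank at
    least n - 1 generate everything, while a product has such a rank only if
    all its factors do; hence a minimal generating set A lies among these
    elements ([minimal_sub_top]).  A product of k elements of A therefore has
    rank at least n - k, and N(S, A) is at least n when the minimum ideal is
    the empty map (PO_n and POI_n), and at least n - 1 when it consists of the
    constants (O_n): this is [minimal_depth_ge].

    That the top elements generate is shown by straightening a map towards a
    partial identity.  If an order preserving s displaces a point, then some
    value y0 = x0 s can be replaced by its neighbour z on the side of x0, where
    z is not a value of s; with t the resulting map, s is t times the map
    sending z to y0 and fixing everything else ([move_toward], [upd_move]), or
    fixing everything else but y0, left undefined, when s is injective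
    ([upd_pmove]).  The total displacement drops, and
    [order_preserving_ind] turns this into an induction principle.  A partial
    identity is a product of the maps [hole i], identities with i removed.

    For PO_n and POI_n, N(S, A) is at most n for every generating set A: the
    first letter of a word for [hole i] must be undefined at i, for otherwise it
    would be total and injective, hence the identity ([generating_kills]).
    So a word can be prolonged by letters that each remove a point from its
    image, and n letters suffice ([short_empty_word]).  As N(S, A) = n for
    every minimal A, all four parameters are n.

    For O_n consider the n maps [cycle_map j]: for j < n - 1 it sends j to
    j + 1 and fixes the rest, and the last one is x |-> x - 1, fixing 0.  They
    generate O_n; since every generating set contains, for each j, a map with
    image X minus j ([O_generating_card]), they form a generating set of
    smallest cardinality.  The power n - 1 of the last one is constant, so this
    set has depth n - 1. *)

(** * Depth parameters of finite semigroups *)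

Lemma least_spec (P : pred nat) : (exists k, P k) ->
  P (least P) /\ forall k, P k -> least P <= k.
Proof.
by move=> exP; rewrite /least; case: pselect => // e; case: ex_minnP.
Qed.

Lemma least_eq (P : pred nat) m :
  P m -> (forall k, P k -> m <= k) -> least P = m.
Proof.
move=> Pm minm; have [Pl le_l] := least_spec (ex_intro _ m Pm).
by apply/eqP; rewrite eqn_leq le_l ?minm.
Qed.

Section Semigroups.
Variable T : finMonoidType.
Implicit Types (S A B K : {set T}) (s : T) (w : seq T).

Lemma productsP k A s :
  reflect (exists w, [/\ size w = k, all [in A] w & s = \prod_(a <- w) a])
          (s \in products k A).
Proof.
apply: (iffP imsetP) => [[w Aw ->]|[w [<- Aw ->]]].
  by exists w; rewrite size_tuple; split => //; rewrite inE in Aw.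
by exists (in_tuple w); rewrite ?inE.
Qed.

(** Allowing the empty word makes decompositions easier to compose; by
    [generating_submonoid] it costs nothing when 1 is not in the semigroup. *)
Definition submonoid A s : Prop :=
  exists2 w, all [in A] w & s = \prod_(a <- w) a.

Lemma submonoid1 A : submonoid A 1.
Proof. by exists [::]; rewrite ?big_nil. Qed.

Lemma submonoidM A s t : submonoid A s -> submonoid A t -> submonoid A (s * t).
Proof.
move=> [u Au ->] [v Av ->]; exists (u ++ v); first by rewrite all_cat Au.
by rewrite big_cat.
Qed.

Lemma submonoid_mem A s : s \in A -> submonoid A s.
Proof. by move=> As; exists [:: s]; rewrite ?big_seq1 //= As. Qed.

Lemma submonoid_trans A B s :
  (forall a, a \in A -> submonoid B a) -> submonoid A s -> submonoid B s.
Proof.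
move=> sAB [w + ->]; elim: w => [|a w IHw] /=.
  by move=> _; rewrite big_nil; apply: submonoid1.
by case/andP=> /sAB Ba /IHw; rewrite big_cons; apply: submonoidM.
Qed.

Lemma generatingP S A :
  reflect [/\ A != set0, A \subset S &
            forall s, s \in S ->
              exists w, [/\ w != [::], all [in A] w & s = \prod_(a <- w) a]]
          (generating S A).
Proof.
apply: (iffP and3P) => [] [A0 sAS gen]; split => //.
  move=> s Ss; have /asboolP [k k0 /productsP [w [sz Aw ->]]] := forall_inP gen s Ss.
  by exists w; rewrite -size_eq0 sz -lt0n.
apply/forall_inP => s /gen [w [w0 Aw ->]]; apply/asboolP.
exists (size w); first by rewrite lt0n size_eq0.
by apply/productsP; exists w.
Qed.

Lemma generating_submonoid S A : 1 \notin S -> S != set0 -> A \subset S ->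
  (forall s, s \in S -> submonoid A s) -> generating S A.
Proof.
move=> S1 /set0Pn [x Sx] sAS gen.
have gen' s : s \in S ->
    exists w, [/\ w != [::], all [in A] w & s = \prod_(a <- w) a].
  move=> Ss; have [w Aw Dw] := gen s Ss; exists w; split=> //.
  by apply: contraNneq S1 => w0; rewrite w0 big_nil in Dw; rewrite -Dw.
apply/generatingP; split=> //.
have [[|a w] [//= _ /andP[Aa _] _]] := gen' x Sx.
by apply/set0Pn; exists a.
Qed.

Lemma generating_self S : S != set0 -> generating S S.
Proof.
move=> S0; apply/generatingP; split=> // s Ss.
by exists [:: s]; rewrite /= Ss big_seq1.
Qed.

Lemma rankP S : S != set0 -> exists A, generating S A /\ #|A| = rank S.
Proof.
move=> S0; have [|/existsP [A /andP[gA /eqP cA]] _] := @least_spec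
    (fun k => [exists A : {set T}, generating S A && (#|A| == k)]).
  by exists #|S|; apply/existsP; exists S; rewrite generating_self /=.
by exists A.
Qed.

Lemma rank_le S A : generating S A -> rank S <= #|A|.
Proof.
move=> gA; apply: (least_spec _).2; last first.
  by apply/existsP; exists A; rewrite gA eqxx.
by exists #|A|; apply/existsP; exists A; rewrite gA eqxx.
Qed.

Lemma rank_minimal S A :
  generating S A -> #|A| = rank S -> minimal_generating S A.
Proof.
move=> gA cA; apply/minsetP; split=> // B gB sBA; apply/eqP.
by rewrite eqEcard sBA cA rank_le.
Qed.

(** Generating sets of cardinality the rank are minimal, so N' and N are squeezed
    between the common lower bound and the depth of the given set. *)
Lemma depth_params_lower S m :
  (forall A, minimal_generating S A -> m <= depth S A) ->
  (exists A, [/\ generating S A, #|A| = rank S & depth S A = m]) ->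
  param_N' S = m /\ param_N S = m.
Proof.
move=> lb [A [gA cA dA]]; split; apply: least_eq.
- by apply/existsP; exists A; rewrite (rank_minimal gA cA) dA /=.
- by move=> k /existsP [B /andP[mB /eqP <-]]; apply: lb.
- by apply/existsP; exists A; rewrite gA cA dA !eqxx.
move=> k /existsP [B /and3P[gB /eqP cB /eqP <-]].
exact/lb/rank_minimal.
Qed.

Lemma depth_params_constant S m : S != set0 ->
  (forall A, minimal_generating S A -> depth S A = m) ->
  [/\ param_N' S = m, param_N S = m, param_M S = m & param_M' S = m].
Proof.
move=> S0 dep; have [A [gA cA]] := rankP S0.
have mA := rank_minimal gA cA.
have [||N'm Nm] := @depth_params_lower S m.
- by move=> B /dep ->.
- by exists A; rewrite dep.
split=> //; apply/eqP; rewrite eqn_leq; apply/andP; split.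
- apply/bigmax_leqP => B /andP[gB /eqP cB].
  by rewrite dep // rank_minimal.
- by apply: (bigmax_sup A); rewrite ?gA ?cA ?eqxx ?dep.
- by apply/bigmax_leqP => B /dep ->.
- by apply: (bigmax_sup A); rewrite ?dep.
Qed.

(** The condition s * c = c puts every c of K in each ideal, because an ideal
    contains some s and hence s * c. *)
Lemma ker_eq S K : K != set0 -> K \subset S ->
  (forall c s, c \in K -> s \in S -> c * s \in K /\ s * c = c) -> ker S = K.
Proof.
move=> K0 sKS KP.
have idK : ideal S K.
  apply/and3P; split=> //; apply/forall_inP => c Kc; apply/forall_inP => s Ss.
  by have [-> ->] := KP c s Kc Ss.
have minK I : ideal S I -> K \subset I.
  case/and3P=> /set0Pn [i Ii] sIS /forall_inP idI; apply/subsetP => c Kc.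
  have [_ <-] := KP c i Kc (subsetP sIS i Ii).
  by have /forall_inP /(_ c (subsetP sKS c Kc)) /andP [] := idI i Ii.
rewrite /ker; case: pickP => [L /andP[idL /forallP minL]|/(_ K)] /=.
  by apply/eqP; rewrite eqEsubset minK // (implyP (minL K)).
by rewrite idK /= => /negP []; apply/forallP => I; apply/implyP => /minK.
Qed.

Lemma word_lengthP S A s : generating S A -> s \in S -> ~~ is_identity S s ->
  (exists w, [/\ size w = word_length S A s, w != [::], all [in A] w
               & s = \prod_(a <- w) a])
  /\ (forall w, w != [::] -> all [in A] w -> s = \prod_(a <- w) a ->
       word_length S A s <= size w).
Proof.
move=> /generatingP [_ _ gen] Ss id'; rewrite /word_length (negPf id').
have mem w : w != [::] -> all [in A] w -> s = \prod_(a <- w) a ->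
    (0 < size w) && (s \in products (size w) A).
  move=> w0 Aw Ds; rewrite lt0n size_eq0 w0 /=.
  by apply/productsP; exists w.
have [w [w0 Aw Ds]] := gen s Ss.
have [/andP[k0 /productsP [v [sv Av Dv]]] min] :=
  least_spec (ex_intro (fun k => (0 < k) && (s \in products k A)) _ (mem w w0 Aw Ds)).
split; last by move=> u u0 Au Du; apply/min/mem.
by exists v; split=> //; rewrite -size_eq0 sv -lt0n.
Qed.

Lemma depth_le S A w : generating S A ->
  (forall s, s \in ker S -> ~~ is_identity S s) -> ker S \subset S ->
  w != [::] -> all [in A] w -> \prod_(a <- w) a \in ker S ->
  depth S A <= size w.
Proof.
move=> gA id' sKS w0 Aw Kw; set s := \prod_(a <- w) a in Kw.
have [_ /(_ w w0 Aw erefl)] := word_lengthP gA (subsetP sKS s Kw) (id' s Kw).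
apply: leq_trans; apply: (least_spec _).2; last by apply/exists_inP; exists s.
by exists (word_length S A s); apply/exists_inP; exists s.
Qed.

Lemma depth_ge S A m : generating S A ->
  (forall s, s \in ker S -> ~~ is_identity S s) -> ker S \subset S ->
  ker S != set0 ->
  (forall w, all [in A] w -> \prod_(a <- w) a \in ker S -> m <= size w) ->
  m <= depth S A.
Proof.
move=> gA id' sKS /set0Pn [c Kc] lb.
have [|/exists_inP [s Ks /eqP]] := @least_spec
    (fun m => [exists s in ker S, word_length S A s == m]).
  by exists (word_length S A c); apply/exists_inP; exists c.
rewrite -/(depth S A) => <- _.
have [[w [<- _ Aw Ds]] _] := word_lengthP gA (subsetP sKS s Ks) (id' s Ks).
by apply: lb; rewrite -?Ds.
Qed.

End Semigroups.

(** An identity in the ideal K would force K to be the whole semigroup.  Elements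
    of K thus escape the convention that the identity has length 0. *)
Lemma ker_not_identity (T : finMonoidType) (S K : {set T}) e : K \proper S ->
  (forall c s, c \in K -> s \in S -> c * s \in K) ->
  e \in K -> ~~ is_identity S e.
Proof.
case/properP=> _ [t St K't] KM Ke; rewrite /is_identity negb_and.
apply/orP; right; apply: contra K't => /forall_inP /(_ t St) /andP[/eqP <- _].
exact: KM.
Qed.

(** * Ranks of partial maps *)

Section PartialMaps.
Variable n : nat.
Implicit Types (S K A : {set pfun n}) (s t c : pfun n) (x y z i : 'I_n).

Lemma pmulE s t x : (s * t) x = obind t (s x).
Proof. by rewrite ffunE. Qed.

Lemma poneE x : (1 : pfun n) x = Some x.
Proof. by rewrite ffunE. Qed.

Definition im_on t (B : {set 'I_n}) : {set 'I_n} := [set y | Some y \in t @: B].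

Definition im s := im_on s setT.

Definition rk s := #|im s|.

Lemma imP s y : reflect (exists x, s x = Some y) (y \in im s).
Proof.
rewrite inE; apply: (iffP imsetP) => [[x _ ->]|[x Dx]]; first by exists x.
by exists x.
Qed.

Lemma Some_im_on t B : Some @: im_on t B = t @: B :\ None.
Proof.
apply/setP => o; apply/imsetP/setD1P => [[y + ->]|[]].
  by rewrite inE.
by case: o => // y _ By; exists y; rewrite ?inE.
Qed.

Lemma card_im_on t B : #|im_on t B| <= #|B|.
Proof.
rewrite -(card_imset _ (@Some_inj _)) Some_im_on.
exact: leq_trans (subset_leq_card (subD1set _ _)) (leq_imset_card _ _).
Qed.

Lemma im_onU t (A B : {set 'I_n}) : im_on t (A :|: B) = im_on t A :|: im_on t B.
Proof. by apply/setP => y; rewrite !inE imsetU inE. Qed.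

Lemma imM s t : im (s * t) = im_on t (im s).
Proof.
apply/setP => y; apply/imP/idP => [[x]|].
  rewrite pmulE; case Dx: (s x) => [z|] //= Dz.
  by rewrite inE; apply/imsetP; exists z => //; apply/imP; exists x.
rewrite inE => /imsetP [z /imP [x Dx] Dz].
by exists x; rewrite pmulE Dx.
Qed.

Lemma rk_mulr s t : rk (s * t) <= rk s.
Proof. by rewrite /rk imM card_im_on. Qed.

Lemma im_mulr s t : im (s * t) \subset im t.
Proof.
apply/subsetP => y /imP [x]; rewrite pmulE; case: (s x) => //= z Dz.
by apply/imP; exists z.
Qed.

Lemma rk_mull s t : rk (s * t) <= rk t.
Proof. exact/subset_leq_card/im_mulr. Qed.

(** The image of t is the union of the images of im s and of its complement, and
    the latter has at most n - rk s points. *)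
Lemma rk_mul_ge s t : rk s + rk t <= rk (s * t) + n.
Proof.
have -> : rk t = #|im_on t (im s) :|: im_on t (~: im s)| by rewrite -im_onU setUCr.
have := cardsC (im s); rewrite card_ord /rk imM.
have := (leq_card_setU (im_on t (im s)) (im_on t (~: im s))).1.
have := card_im_on t (~: im s); lia.
Qed.

Lemma im1 : im 1 = setT.
Proof. by apply/setP => y; rewrite in_setT; apply/imP; exists y; rewrite poneE. Qed.

Lemma rk1 : rk 1 = n.
Proof. by rewrite /rk im1 cardsT card_ord. Qed.

Lemma rk_near_full z s : (forall w, w != z -> w \in im s) -> n.-1 <= rk s.
Proof.
move=> near; have := cardsC1 z; rewrite card_ord => <-.
by apply/subset_leq_card/subsetP => w; rewrite !inE => /near; rewrite inE.
Qed.

Lemma rk_total_inj s : (forall x, s x != None) ->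
  (forall x y, s x = s y -> x = y) -> rk s = n.
Proof.
move=> tot inj; rewrite /rk -(card_imset _ (@Some_inj _)) Some_im_on.
have -> : s @: setT :\ None = s @: setT.
  apply/setDidPl; rewrite disjoint_sym disjoints1.
  by apply/imsetP => -[x _ /esym /eqP]; apply/negP.
by rewrite card_imset ?cardsT ?card_ord.
Qed.

Lemma rk_factor (w : seq (pfun n)) a : a \in w -> rk (\prod_(b <- w) b) <= rk a.
Proof.
elim: w => // b w IHw; rewrite inE big_cons => /predU1P [->|/IHw].
  exact: rk_mulr.
exact: leq_trans (rk_mull _ _).
Qed.

Lemma rk_prod_ge (w : seq (pfun n)) : (forall a, a \in w -> n.-1 <= rk a) ->
  n <= rk (\prod_(a <- w) a) + size w.
Proof.
elim: w => [|a w IHw] big; first by rewrite big_nil rk1 addn0.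
have {}IHw := IHw (fun b wb => big b (mem_behead (s := a :: w) wb)).
rewrite big_cons /=; move: (\prod_(b <- w) b) IHw => p IHw.
have := rk_mul_ge a p; have := big a (mem_head _ _); move: (rk (a * p)); lia.
Qed.

(** * Minimal generating sets consist of maps of large rank *)

Definition top (S : {set pfun n}) := [set s in S | n.-1 <= rk s].

(** A word in A for an element of rank at least n - 1 uses only letters of such
    rank, so the part of A in the top already generates the top, hence S. *)
Lemma minimal_sub_top S A : 1 \notin S ->
  (forall s, s \in S -> submonoid (top S) s) ->
  minimal_generating S A -> A \subset top S.
Proof.
move=> S1 topS mA; have gA := minsetp mA.
have [A0 sAS gen] := generatingP _ _ gA.
have gB : generating S (A :&: top S).
  apply: generating_submonoid => // [||s Ss].
  - by apply: contraNneq A0 => S0; rewrite -subset0 -S0.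
  - exact: subset_trans (subsetIl _ _) sAS.
  apply: submonoid_trans (topS s Ss) => t; rewrite inE => /andP[St rt].
  have [w [_ Aw Dt]] := gen t St; exists w => //.
  apply/allP => a wa; have Aa := allP Aw a wa.
  rewrite !inE Aa (subsetP sAS) //=.
  by apply: leq_trans rt _; rewrite Dt; apply: rk_factor.
by rewrite -(minsetinf mA gB (subsetIl _ _)) subsetIr.
Qed.

(** The value of a word of length k in A has rank at least n - k, and it must be
    at most r for the word to reach K. *)
Lemma minimal_depth_ge S K A r : 1 \notin S -> K != set0 -> K \proper S ->
  (forall c s, c \in K -> s \in S -> c * s \in K /\ s * c = c) ->
  (forall c, c \in K -> rk c <= r) ->
  (forall s, s \in S -> submonoid (top S) s) ->
  minimal_generating S A -> n - r <= depth S A.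
Proof.
move=> S1 K0 pKS KP Kr topS mA; have sAt := minimal_sub_top S1 topS mA.
have kS := ker_eq K0 (proper_sub pKS) KP.
apply: depth_ge (minsetp mA) _ _ _ _; rewrite ?kS ?proper_sub //.
  by move=> s; apply: ker_not_identity pKS _ => c t Kc St; have [] := KP c t Kc St.
move=> w Aw /Kr; have := @rk_prod_ge w.
have big a : a \in w -> n.-1 <= rk a.
  by move/(allP Aw)/(subsetP sAt); rewrite inE => /andP[].
by move/(_ big); move: (rk _) (size w) => q k; lia.
Qed.

(** * Order preserving partial maps *)

Lemma order_preservingP s :
  reflect (forall x y a b, s x = Some a -> s y = Some b -> x <= y -> a <= b)
          (order_preserving s).
Proof.
apply: (iffP forallP) => op x.
  move=> y a b Da Db le_xy.
  move: (op x) => /forallP/(_ y)/forallP/(_ a)/forallP/(_ b).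
  by rewrite Da Db !eqxx le_xy.
apply/forallP => y; apply/forallP => a; apply/forallP => b; apply/implyP.
by case/and3P=> /eqP Da /eqP Db; apply: op Da Db.
Qed.

Definition upd s x z : pfun n := [ffun w => if w == x then Some z else s w].

Definition move z y : pfun n := [ffun w => if w == z then Some y else Some w].

(** The injective counterpart of [move z y]. *)
Definition pmove z y : pfun n :=
  [ffun w => if w == z then Some y else if w == y then None else Some w].

Lemma upd_move s x y z : s x = Some y -> z \notin im s ->
  s = upd s x z * move z y.
Proof.
move=> Dx imz; apply/ffunP => w; rewrite pmulE ffunE.
have [-> | _] := eqVneq w x; first by rewrite /= ffunE eqxx.
case Dw: (s w) => [v|] //=; rewrite ffunE; case: eqP => // vz.
by case/imP: imz; exists w; rewrite Dw vz.
Qed.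

Lemma upd_pmove s x y z : injective_pfun s -> s x = Some y -> z \notin im s ->
  s = upd s x z * pmove z y.
Proof.
move=> inj Dx imz; apply/ffunP => w; rewrite pmulE ffunE.
have [-> | w'x] := eqVneq w x; first by rewrite /= ffunE eqxx.
case Dw: (s w) => [v|] //=; rewrite ffunE; case: eqP => [vz|_].
  by case/imP: imz; exists w; rewrite Dw vz.
case: eqP => // vy; case/eqP: w'x; apply/eqP.
move/forallP/(_ w)/forallP/(_ x): inj.
by rewrite Dw Dx vy eqxx.
Qed.

Definition adjacent_toward x y z :=
  (y == z.+1 :> nat) && (x <= z) || (z == y.+1 :> nat) && (z <= x).

(** If some point moves up, take the least such point x0, with value y0: the
    points below x0 have values below x0 and the others have values at least
    y0, so y0 - 1 is not a value and x0 may be sent there without breaking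
    monotonicity.  If some point moves down, argue dually with the greatest
    such point. *)
Lemma move_toward s x y : order_preserving s -> s x = Some y -> x != y ->
  exists x0 y0 z, [/\ s x0 = Some y0, adjacent_toward x0 y0 z, z \notin im s
                    & order_preserving (upd s x0 z)].
Proof.
move=> /order_preservingP op Dx; rewrite neq_ltn => /orP[lt_xy | lt_yx].
  pose P u := if s u is Some v then u < v else false.
  have Px : P x by rewrite /P Dx.
  case: (arg_minnP (fun u : 'I_n => val u) Px) => x0.
  rewrite {1}/P; case Dx0: (s x0) => [y0|] // lt0 min.
  have below u v : s u = Some v -> u < x0 -> v <= u.
    move=> Du ltu; rewrite leqNgt; apply/negP => ltv.
    by have := min u; rewrite /P Du => /(_ ltv); rewrite leqNgt ltu.
  have z_lt : y0.-1 < n by have := ltn_ord y0; lia.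
  exists x0, y0, (Ordinal z_lt); split=> //=.
  - by apply/orP; left; apply/andP; split=> /=; lia.
  - apply/imP => -[u Du]; have [ltu|leu] := ltnP u x0.
      by have := below _ _ Du ltu; rewrite /=; lia.
    by have := op _ _ _ _ Dx0 Du leu; rewrite /=; lia.
  apply/order_preservingP => u v a b; rewrite !ffunE.
  case: (eqVneq u x0) => [-> [<-]|u'x Da]; case: (eqVneq v x0) => [-> [<-]|v'x] //=.
  - by move=> Db le; have := op _ _ _ _ Dx0 Db le; lia.
  - move=> le; have ltu : u < x0 by rewrite ltn_neqAle u'x.
    by have := below _ _ Da ltu; lia.
  exact: op Da.
pose P u := if s u is Some v then v < u else false.
have Px : P x by rewrite /P Dx.
case: (arg_maxnP (fun u : 'I_n => val u) Px) => x0.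
rewrite {1}/P; case Dx0: (s x0) => [y0|] // lt0 max.
have above u v : s u = Some v -> x0 < u -> u <= v.
  move=> Du ltu; rewrite leqNgt; apply/negP => ltv.
  by have := max u; rewrite /P Du => /(_ ltv) /=; rewrite leqNgt ltu.
have z_lt : y0.+1 < n by have := ltn_ord x0; lia.
exists x0, y0, (Ordinal z_lt); split=> //=.
- by apply/orP; right; apply/andP; split=> /=; lia.
- apply/imP => -[u Du]; have [ltu|leu] := ltnP x0 u.
    by have := above _ _ Du ltu; rewrite /=; lia.
  by have := op _ _ _ _ Du Dx0 leu; rewrite /=; lia.
apply/order_preservingP => u v a b; rewrite !ffunE.
case: (eqVneq u x0) => [-> [<-]|u'x Da]; case: (eqVneq v x0) => [-> [<-]|v'x] //=.
- move=> Db le; have ltu : x0 < v by rewrite ltn_neqAle eq_sym v'x.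
  by have := above _ _ Db ltu; lia.
- by move=> le; have := op _ _ _ _ Da Dx0 le; rewrite /=; lia.
exact: op Da.
Qed.

Definition displacement s :=
  \sum_x (if s x is Some y then (x - y) + (y - x) else 0).

Lemma displacement_upd s x y z : s x = Some y -> adjacent_toward x y z ->
  displacement (upd s x z) < displacement s.
Proof.
move=> Dx adj; rewrite /displacement (bigD1 x) //= [ltnRHS](bigD1 x) //=.
rewrite ffunE eqxx Dx.
rewrite (eq_bigr (fun u => if s u is Some v then (u - v) + (v - u) else 0)); last first.
  by move=> u /negPf u'x; rewrite ffunE u'x.
by rewrite ltn_add2r; move: adj; rewrite /adjacent_toward; lia.
Qed.

(** Induction on the displacement: order preserving maps are reached from partial
    identities by reversing the steps of [move_toward]. *)
Lemma order_preserving_ind (P : pfun n -> Prop) :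
  (forall s, (forall x y, s x = Some y -> x = y) -> P s) ->
  (forall s x y z, s x = Some y -> adjacent_toward x y z -> z \notin im s ->
     P (upd s x z) -> P s) ->
  forall s, order_preserving s -> P s.
Proof.
move=> Pid Pmove s; have [m] := ubnP (displacement s).
elim: m s => // m IHm s le_s op.
have [/existsP [x /existsP [y /andP[/eqP Dx neq]]] | /negP fixed] :=
    boolP [exists x, exists y, (s x == Some y) && (x != y)].
  have [x0 [y0 [z [Dx0 adj imz op']]]] := move_toward op Dx neq.
  apply: (Pmove s x0 y0 z) => //; apply: IHm => //.
  exact: leq_trans (displacement_upd Dx0 adj) _.
apply: Pid => x y Dx; apply/eqP/negPn/negP => neq; apply: fixed.
by apply/existsP; exists x; apply/existsP; exists y; rewrite Dx eqxx.
Qed.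

(** By [move_toward], a map that displaces a point misses some value. *)
Lemma order_preserving_full s : order_preserving s -> rk s = n -> s = 1.
Proof.
move=> op rks; have imT : im s = setT.
  by apply/eqP; rewrite eqEcard subsetT cardsT card_ord -/(rk s) rks leqnn.
have fix_s x y : s x = Some y -> x = y.
  move=> Dx; apply/eqP/negPn/negP => /(move_toward op Dx) [x0 [y0 [z [_ _ + _]]]].
  by rewrite imT inE.
apply/ffunP => x; have /imP [u Du] : x \in im s by rewrite imT inE.
by rewrite poneE -[in LHS](fix_s _ _ Du).
Qed.

(** * Semigroups with the empty map *)

Definition empty_map : pfun n := [ffun=> None].

Definition hole i : pfun n := [ffun w => if w == i then None else Some w].

Lemma hole_neq1 i : hole i != 1.
Proof. by apply/eqP => /ffunP/(_ i); rewrite !ffunE eqxx. Qed.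

Lemma order_preserving_hole i : order_preserving (hole i).
Proof.
apply/order_preservingP => x y a b; rewrite !ffunE.
by case: eqP => // _ [<-]; case: eqP => // _ [<-].
Qed.

Lemma rk_hole i : n.-1 <= rk (hole i).
Proof.
apply: (@rk_near_full i) => w /negPf w'i.
by apply/imP; exists w; rewrite ffunE w'i.
Qed.

(** Fill the undefined points one at a time. *)
Lemma partial_identity_holes A s : (forall i, submonoid A (hole i)) ->
  (forall x y, s x = Some y -> x = y) -> submonoid A s.
Proof.
move=> Ahole; have [m] := ubnP #|[set x | s x == None]|.
elim: m s => // m IHm s le_s fix_s.
have [[i]|] := pselect (exists i, s i = None); last first.
  move=> tot; suff -> : s = 1 by apply: submonoid1.
  apply/ffunP => x; rewrite poneE; case Dx: (s x) => [y|].
    by rewrite -(fix_s _ _ Dx).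
  by case: tot; exists x.
move=> Di; have -> : s = upd s i i * hole i.
  apply/ffunP => w; rewrite pmulE !ffunE.
  case: (eqVneq w i) => [->|w'i] /=; first by rewrite ffunE eqxx.
  case Dw: (s w) => [v|] //=; rewrite ffunE -(fix_s _ _ Dw).
  by rewrite (negPf w'i).
apply: submonoidM => //; apply: IHm => [|x y]; last first.
  by rewrite ffunE; case: eqP => [-> [<-]|_ /fix_s].
rewrite ltnS in le_s; apply: leq_trans _ le_s; apply: proper_card.
apply/properP; split; last by exists i; rewrite !inE ?Di // ffunE eqxx.
by apply/subsetP => x; rewrite !inE ffunE; case: ifP.
Qed.

(** The first letter a of a word for [hole i] is defined and injective off i.  If
    it were defined at i, it would be total, and it could not send i and some
    x to the same point, because [hole i] is defined at x and not at i; then a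
    would be total and injective, hence equal to 1. *)
Lemma generating_kills S A i : (forall s, s \in S -> order_preserving s) ->
  1 \notin S -> hole i \in S -> generating S A -> exists2 a, a \in A & a i = None.
Proof.
move=> op S1 Si /generatingP [_ sAS /(_ _ Si) [[|a w] [//= _ /andP[Aa _]]]].
rewrite big_cons; set p := \prod_(b <- w) b => Dh; exists a => //.
apply/eqP/negPn/negP => ai; have Sa := subsetP sAS a Aa.
have holeE x : x != i -> obind p (a x) = Some x.
  by move=> /negPf x'i; rewrite -pmulE -Dh ffunE x'i.
have hole_i : obind p (a i) = None by rewrite -pmulE -Dh ffunE eqxx.
suff a1 : a = 1 by rewrite -a1 Sa in S1.
apply: order_preserving_full (op a Sa) (rk_total_inj _ _) => [x|x y eq_xy].
  by have [->//|/holeE] := eqVneq x i; case: (a x).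
have [xi|/holeE] := eqVneq x i; have [yi|/holeE] := eqVneq y i.
- by rewrite xi yi.
- by rewrite -eq_xy xi hole_i.
- by rewrite eq_xy yi hole_i.
by rewrite eq_xy => -> [].
Qed.

Lemma rk_kill s (a : pfun n) i : i \in im s -> a i = None -> rk (s * a) < rk s.
Proof.
move=> si ai; rewrite /rk imM (cardsD1 i (im s)) si add1n ltnS.
apply: leq_trans (card_im_on a _); apply/subset_leq_card/subsetP => y.
rewrite !inE => /imsetP [x sx Dx]; apply/imsetP; exists x => //.
by apply/setD1P; split=> //; apply/eqP => xi; rewrite xi ai in Dx.
Qed.

Lemma rk_eq0 s : rk s = 0 -> s = empty_map.
Proof.
move/cards0_eq => s0; apply/ffunP => x; rewrite ffunE; case Dx: (s x) => [y|] //.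
by have := in_set0 y; rewrite -s0 => /imP []; exists x.
Qed.

(** As long as the image of the word is not empty, prolong it by a letter that is
    undefined at one of its points. *)
Lemma short_empty_word A k : 0 < n -> (forall i, exists2 a, a \in A & a i = None) ->
  exists w, [/\ size w = k, all [in A] w & rk (\prod_(a <- w) a) <= n - k].
Proof.
move=> n0 kill; elim: k => [|k [w [sw Aw rw]]].
  by exists [::]; rewrite big_nil rk1 subn0.
have [a Aa ra] : exists2 a, a \in A & rk (\prod_(b <- w) b * a) <= n - k.+1.
  have [/eqP r0|] := posnP (rk (\prod_(b <- w) b)).
    have [a Aa _] := kill (Ordinal n0); exists a => //.
    by rewrite (leq_trans (rk_mulr _ _)) // (eqP r0).
  rewrite card_gt0 => /set0Pn [i Di]; have [a Aa ai] := kill i.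
  exists a => //; have := leq_trans (rk_kill Di ai) rw; move: (rk _); lia.
exists (w ++ [:: a]); rewrite size_cat sw addn1 all_cat Aw /= Aa.
by rewrite big_cat big_seq1.
Qed.

Lemma params_with_zero S : 1 < n -> 1 \notin S ->
  (forall s, s \in S -> order_preserving s) ->
  empty_map \in S -> (forall i, hole i \in S) ->
  (forall s, s \in S -> submonoid (top S) s) ->
  [/\ param_N' S = n, param_N S = n, param_M S = n & param_M' S = n].
Proof.
move=> n1 S1 op S0 Shole topS.
have mul0 s : empty_map * s = empty_map /\ s * empty_map = empty_map.
  split; apply/ffunP => x; rewrite pmulE !ffunE //.
  by case: (s x) => //= y; rewrite ffunE.
have K0 : [set empty_map] != set0 by apply/set0Pn; exists empty_map; rewrite inE.
have KP c s : c \in [set empty_map] -> s \in S ->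
    c * s \in [set empty_map] /\ s * c = c.
  by move/set1P=> -> _; have [-> ->] := mul0 s; rewrite inE.
have pK : [set empty_map] \proper S.
  rewrite properE sub1set S0 /=; apply/subsetPn.
  pose i := Ordinal (ltnW n1); exists (hole i) => //; apply/set1P/ffunP.
  by move/(_ (Ordinal n1)); rewrite !ffunE.
have kS := ker_eq K0 (proper_sub pK) KP.
apply: depth_params_constant => [|A mA]; first by apply/set0Pn; exists empty_map.
apply/eqP; rewrite eqn_leq; apply/andP; split; last first.
  rewrite -[leqLHS]subn0; apply: (minimal_depth_ge S1 K0 pK KP _ topS mA) => c.
  move/set1P ->; rewrite leqn0 cards_eq0; apply/eqP/setP => y; rewrite in_set0.
  by apply/imP => -[x]; rewrite ffunE.
have gA := minsetp mA.
have [w [sw Aw]] := short_empty_word n (ltnW n1)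
  (fun i => generating_kills op S1 (Shole i) gA).
rewrite subnn leqn0 => /eqP/rk_eq0 Dw.
rewrite -[leqRHS]sw; apply: depth_le => //; rewrite ?kS ?proper_sub ?Dw ?inE //.
  by move=> s; apply: ker_not_identity pK _ => c t Kc /(KP c t Kc) [].
by rewrite -size_eq0 sw; case: (n) n1.
Qed.

(** * Generation of PO_n and POI_n *)

Lemma order_preserving_near_id z y s : (y == z.+1 :> nat) || (z == y.+1 :> nat) ->
  (forall w v, s w = Some v -> v = (if w == z then y else w)) ->
  order_preserving s.
Proof.
move=> adj sE; apply/order_preservingP => u v a b /sE -> /sE ->.
case: (eqVneq u z) => [->|]; case: (eqVneq v z) => [->|]; rewrite -?val_eqE /=; lia.
Qed.

Lemma adjacent_toward_neighbours x y z : adjacent_toward x y z ->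
  (y == z.+1 :> nat) || (z == y.+1 :> nat).
Proof. by case/orP => /andP[-> _]; rewrite ?orbT. Qed.

Section Moves.
Variables y z : 'I_n.
Hypothesis adj : (y == z.+1 :> nat) || (z == y.+1 :> nat).

Let neq : y != z.
Proof. by rewrite -val_eqE /=; move: adj; lia. Qed.

Lemma order_preserving_move : order_preserving (move z y).
Proof.
by apply: order_preserving_near_id adj _ => w v; rewrite ffunE; case: eqP => _ [].
Qed.

Lemma order_preserving_pmove : order_preserving (pmove z y).
Proof.
apply: order_preserving_near_id adj _ => w v; rewrite ffunE.
by case: eqP => [_ []|_] //; case: eqP => // _ [].
Qed.

Lemma rk_move : n.-1 <= rk (move z y).
Proof.
apply: (@rk_near_full z) => w /negPf w'z; apply/imP.
by exists w; rewrite ffunE w'z.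
Qed.

Lemma rk_pmove : n.-1 <= rk (pmove z y).
Proof.
apply: (@rk_near_full z) => w /negPf w'z; apply/imP.
have [->|/negPf w'y] := eqVneq w y; first by exists z; rewrite ffunE eqxx.
by exists w; rewrite ffunE w'z w'y.
Qed.

Lemma move_neq1 : move z y != 1.
Proof.
by apply/eqP => /ffunP/(_ z); rewrite !ffunE eqxx => -[/eqP]; rewrite (negPf neq).
Qed.

Lemma pmove_neq1 : pmove z y != 1.
Proof.
by apply/eqP => /ffunP/(_ z); rewrite !ffunE eqxx => -[/eqP]; rewrite (negPf neq).
Qed.

End Moves.

Lemma in_PO s : (s \in PO_sg n) = (s != 1) && order_preserving s.
Proof. by rewrite !inE andbT. Qed.

Lemma in_POI s :
  (s \in POI_sg n) = [&& s != 1, injective_pfun s & order_preserving s].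
Proof. by rewrite !inE /= andbA. Qed.

Lemma in_O s : (s \in O_sg n) = [&& s != 1, total_pfun s & order_preserving s].
Proof. by rewrite !inE /= andbA. Qed.

Lemma PO_params : 1 < n -> [/\ param_N' (PO_sg n) = n, param_N (PO_sg n) = n,
  param_M (PO_sg n) = n & param_M' (PO_sg n) = n].
Proof.
move=> n1; apply: params_with_zero => // [||||].
- by rewrite in_PO eqxx.
- by move=> s; rewrite in_PO => /andP[].
- rewrite in_PO; apply/andP; split.
    by apply/eqP => /ffunP/(_ (Ordinal n1)); rewrite !ffunE.
  by apply/order_preservingP => x y a b; rewrite ffunE.
- by move=> i; rewrite in_PO hole_neq1 order_preserving_hole.
move=> s; rewrite in_PO => /andP[_]; move: s.
apply: order_preserving_ind => [s|s x y z Dx /adjacent_toward_neighbours adj imz IH].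
  apply: partial_identity_holes => i; apply: submonoid_mem.
  by rewrite inE in_PO hole_neq1 order_preserving_hole rk_hole.
rewrite (upd_move Dx imz); apply: submonoidM => //; apply: submonoid_mem.
by rewrite inE in_PO move_neq1 // order_preserving_move ?rk_move.
Qed.

Lemma injective_pfunP s :
  reflect (forall x y v, s x = Some v -> s y = Some v -> x = y) (injective_pfun s).
Proof.
apply: (iffP forallP) => inj x.
  move=> y v Dx Dy; move: (inj x) => /forallP/(_ y).
  by rewrite Dx Dy eqxx => /eqP.
apply/forallP => y; apply/implyP => /andP[]; case Dx: (s x) => [v|] // _ /eqP Dy.
by apply/eqP; apply: inj Dx _.
Qed.

Lemma POI_params : 1 < n -> [/\ param_N' (POI_sg n) = n, param_N (POI_sg n) = n,
  param_M (POI_sg n) = n & param_M' (POI_sg n) = n].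
Proof.
move=> n1.
have inj_hole i : injective_pfun (hole i).
  apply/injective_pfunP => x y v; rewrite !ffunE.
  by case: eqP => // _ [->]; case: eqP => // _ [->].
apply: params_with_zero => // [||||].
- by rewrite in_POI eqxx.
- by move=> s; rewrite in_POI => /and3P[].
- rewrite in_POI; apply/and3P; split.
  + by apply/eqP => /ffunP/(_ (Ordinal n1)); rewrite !ffunE.
  + by apply/injective_pfunP => x y v; rewrite ffunE.
  by apply/order_preservingP => x y a b; rewrite ffunE.
- by move=> i; rewrite in_POI hole_neq1 inj_hole order_preserving_hole.
move=> s; rewrite in_POI => /and3P[_ + op]; move: s op.
apply: order_preserving_ind => [s fix_s _|s x y z Dx /adjacent_toward_neighbours adj imz IH inj].
  apply: partial_identity_holes fix_s => i; apply: submonoid_mem.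
  by rewrite inE in_POI hole_neq1 inj_hole order_preserving_hole rk_hole.
rewrite (upd_pmove inj Dx imz); apply: submonoidM.
  apply: IH; apply/injective_pfunP => u v a; rewrite !ffunE.
  case: (eqVneq u x) => [-> [<-]|_ Da]; case: (eqVneq v x) => [->|_ Db] //.
  - by case/imP: imz; exists v.
  - by case=> Dz; case/imP: imz; exists u; rewrite Dz.
  exact: (injective_pfunP _ inj) Da Db.
apply: submonoid_mem.
rewrite inE in_POI pmove_neq1 // order_preserving_pmove ?rk_pmove //= !andbT.
apply/injective_pfunP => u v a; rewrite !ffunE.
case: (eqVneq u z) => [->|_]; case: (eqVneq v z) => [->|_] //.
- by move=> [->]; case: eqP => // v'a [/v'a].
- by case: eqP => // u'y [<-] [/esym/u'y].
by case: eqP => // _ [->]; case: eqP => // _ [->].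
Qed.

(** * Full maps *)

(** Describing full maps by functions on nat lets products be computed by plain
    arithmetic; indices sent outside the range become undefined. *)
Definition of_nat_fun (f : nat -> nat) : pfun n := [ffun w : 'I_n => insub (f w)].

Lemma of_nat_funP (f : nat -> nat) (w : 'I_n) : f w < n ->
  exists2 y : 'I_n, of_nat_fun f w = Some y & y = f w :> nat.
Proof. by move=> fw; exists (Ordinal fw); rewrite // ffunE insubT. Qed.

Lemma of_nat_fun_some (f : nat -> nat) (w y : 'I_n) : of_nat_fun f w = Some y -> y = f w :> nat.
Proof. by rewrite ffunE; case: insubP => // u _ <- [->]. Qed.

Lemma eq_of_nat_fun (f g : nat -> nat) : (forall k, k < n -> f k = g k) ->
  of_nat_fun f = of_nat_fun g.
Proof. by move=> fg; apply/ffunP => w; rewrite !ffunE fg. Qed.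

Lemma of_nat_funM (f g : nat -> nat) : (forall k, k < n -> f k < n) ->
  of_nat_fun f * of_nat_fun g = of_nat_fun (fun k => g (f k)).
Proof.
move=> fP; apply/ffunP => w; rewrite pmulE.
have [y -> Dy] := of_nat_funP (fP w (ltn_ord w)).
by rewrite /= !ffunE Dy.
Qed.

Lemma of_nat_fun_id : of_nat_fun id = 1.
Proof. by apply/ffunP => w; rewrite !ffunE valK. Qed.

Lemma total_of_nat_fun (f : nat -> nat) : (forall k, k < n -> f k < n) -> total_pfun (of_nat_fun f).
Proof.
move=> fP; apply/forallP => w.
by have [y -> _] := of_nat_funP (fP w (ltn_ord w)).
Qed.

Lemma order_preserving_of_nat_fun (f : nat -> nat) :
  (forall j k, j <= k -> f j <= f k) -> order_preserving (of_nat_fun f).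
Proof.
move=> fP; apply/order_preservingP => x y a b.
by move=> /of_nat_fun_some -> /of_nat_fun_some ->; apply: fP.
Qed.

Lemma moveE z y : move z y = of_nat_fun (fun k => if k == z :> nat then val y else k).
Proof.
by apply/ffunP => w; rewrite !ffunE -val_eqE /=; case: eqP => _; rewrite valK.
Qed.

(** For j < n - 1 the map merges j with j + 1 and misses the value j; the last one
    merges 0 with 1 and misses n - 1.  Hence they can be composed in the cyclic
    order j, j - 1, ..., 0, n - 1, n - 2, ... without loss of rank. *)
Definition cycle_fun (j k : nat) :=
  if j.+1 == n then k.-1 else if k == j then k.+1 else k.

Definition cycle_map (j : 'I_n) := of_nat_fun (cycle_fun j).

Definition cycle_maps : {set pfun n} := [set cycle_map j | j : 'I_n].

Lemma im_cycle_map (j : 'I_n) : 1 < n -> im (cycle_map j) = ~: [set j].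
Proof.
move=> n1; have jn := ltn_ord j.
apply/setP => y; rewrite in_setC1; apply/imP/idP => [[x /of_nat_fun_some]|].
  have := ltn_ord x; rewrite -val_eqE /cycle_fun /=.
  by case: eqP => ?; last case: eqP => ?; move=> ? ?; apply/eqP; lia.
rewrite -val_eqE /= => yj; have yn := ltn_ord y.
have hit k : k < n -> cycle_fun j k = y -> exists x, cycle_map j x = Some y.
  move=> kn Dk; exists (Ordinal kn).
  have [|z -> Dz] := @of_nat_funP (cycle_fun j) (Ordinal kn); first by rewrite /= Dk.
  by congr Some; apply: val_inj; rewrite /= Dz.
have [jl|jl] := eqVneq j.+1 n.
  by apply: (hit y.+1); rewrite /cycle_fun ?jl ?eqxx //; lia.
by apply: (hit y) => //; rewrite /cycle_fun (negPf jl) (negPf yj).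
Qed.

Lemma cycle_map_in_top j : 1 < n -> cycle_map j \in top (O_sg n).
Proof.
move=> n1; have imj := im_cycle_map j n1; have jn := ltn_ord j.
rewrite inE in_O -!andbA; apply/and4P; split.
- apply: contraTneq (in_setT j) => j1.
  by rewrite -im1 -[X in im X]j1 imj !inE eqxx.
- by apply: total_of_nat_fun => k; rewrite /cycle_fun; case: eqP => ?; first lia;
    case: eqP; lia.
- by apply: order_preserving_of_nat_fun => i k; rewrite /cycle_fun; case: eqP => ?;
    first lia; case: eqP => ?; case: eqP; lia.
by apply: (@rk_near_full j) => w; rewrite imj !inE.
Qed.

Lemma total_upd s x z : total_pfun s -> total_pfun (upd s x z).
Proof.
by move=> /forallP tot; apply/forallP => w; rewrite ffunE; case: ifP.
Qed.

Lemma total_fixing s : total_pfun s ->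
  (forall x y, s x = Some y -> x = y) -> s = 1.
Proof.
move=> /forallP tot fix_s; apply/ffunP => x; rewrite poneE.
by case Dx: (s x) (tot x) => [y|] //; rewrite -(fix_s _ _ Dx).
Qed.

(** For maps with x <= x s, each step of [order_preserving_ind] lowers a value, so
    only the maps j |-> j + 1 are used. *)
Lemma extensive_cycle_maps s : order_preserving s -> total_pfun s ->
  (forall x y, s x = Some y -> x <= y) -> submonoid cycle_maps s.
Proof.
move: s; apply: order_preserving_ind => [s fix_s tot _|s x y z Dx adj imz IH tot ext].
  by rewrite (total_fixing tot fix_s); apply: submonoid1.
have le_xy := ext _ _ Dx.
have [yz le_xz] : y = z.+1 :> nat /\ x <= z.
  by case/orP: adj => /andP[/eqP ? ?]; lia.
rewrite (upd_move Dx imz); apply: submonoidM.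
  apply: IH; first exact: total_upd.
  by move=> u v; rewrite ffunE; case: eqP => [-> [<-]|_ /ext].
apply: submonoid_mem; apply/imsetP; exists z => //.
rewrite moveE; apply: eq_of_nat_fun => k _; rewrite /cycle_fun /=.
by rewrite -yz (ltn_eqF (ltn_ord y)) yz; case: eqP => // ->.
Qed.

Lemma of_nat_fun_extensive (f : nat -> nat) : (forall k, k < n -> f k < n) ->
  (forall j k, j <= k -> f j <= f k) -> (forall k, k <= f k) ->
  submonoid cycle_maps (of_nat_fun f).
Proof.
move=> fn fmono fext; apply: extensive_cycle_maps.
- exact: order_preserving_of_nat_fun.
- exact: total_of_nat_fun.
by move=> x y /of_nat_fun_some ->.
Qed.

Lemma pred_map_in_cycle_maps : 0 < n -> of_nat_fun predn \in cycle_maps.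
Proof.
move=> n0; have last_n : n.-1 < n by lia.
apply/imsetP; exists (Ordinal last_n) => //.
by apply: eq_of_nat_fun => k _; rewrite /cycle_fun /= prednK // eqxx.
Qed.

(** The map y + 1 |-> y is obtained by raising the points up to y by one, lowering
    everything by one, and raising back the points above y: the outer two
    factors are extensive, the middle one is the last cycle map. *)
Lemma move_down_cycle_maps y z : z = y.+1 :> nat -> submonoid cycle_maps (move z y).
Proof.
move=> zy; have zn := ltn_ord z.
pose u k := if k <= y then k.+1 else k.
pose v k := if y < k < n.-1 then k.+1 else k.
have un k : k < n -> u k < n by rewrite /u; case: ifP; lia.
have -> : move z y = of_nat_fun u * of_nat_fun predn * of_nat_fun v.
  rewrite of_nat_funM // of_nat_funM; last by move=> k /un; lia.
  rewrite moveE; apply: eq_of_nat_fun => k kn; rewrite /u /v zy /=.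
  by case: (leqP k y) => ky; case: (eqVneq k y.+1) => ?; case: ifP; lia.
apply: submonoidM; first apply: submonoidM.
- apply: of_nat_fun_extensive un _ _ => [j k|k]; rewrite /u.
    by case: ifP => ?; case: ifP; lia.
  by case: ifP.
- by apply: submonoid_mem; apply: pred_map_in_cycle_maps; lia.
apply: of_nat_fun_extensive => [k|j k|k]; rewrite /v.
- by case: ifP; lia.
- by case: ifP => ?; case: ifP; lia.
by case: ifP.
Qed.

Lemma O_cycle_maps s : s \in O_sg n -> submonoid cycle_maps s.
Proof.
rewrite in_O => /and3P[_ + op]; move: s op.
apply: order_preserving_ind => [s fix_s tot|s x y z Dx adj imz IH tot].
  by rewrite (total_fixing tot fix_s); apply: submonoid1.
rewrite (upd_move Dx imz); apply: submonoidM; first by apply/IH/total_upd.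
case/orP: adj => /andP[/eqP yz _]; last exact: move_down_cycle_maps.
rewrite moveE; apply: of_nat_fun_extensive => [k|j k|k].
- by case: eqP => // _ _; apply: ltn_ord.
- by rewrite /=; case: eqP => ?; case: eqP; lia.
by rewrite /=; case: eqP; lia.
Qed.

Lemma O_im_proper s : s \in O_sg n -> im s != setT.
Proof.
rewrite in_O => /and3P[s1 _ op]; apply: contraNneq s1 => imT.
by rewrite (order_preserving_full op) // /rk imT cardsT card_ord.
Qed.

(** The last letter of a word for [cycle_map j] has image containing X minus j; it
    is not onto, being distinct from 1, so its image is X minus j.  Distinct
    j thus give distinct letters. *)
Lemma O_generating_card A : 1 < n -> generating (O_sg n) A -> n <= #|A|.
Proof.
move=> n1 /generatingP [_ sAS gen].
have n_eq : #|[set ~: [set j] | j : 'I_n]| = n.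
  by rewrite card_imset ?card_ord // => i j /setC_inj /set1_inj.
rewrite -[leqLHS]n_eq; apply: leq_trans (leq_imset_card im A).
apply/subset_leq_card/subsetP => _ /imsetP [j _ ->].
have imj := im_cycle_map j n1.
have Oj : cycle_map j \in O_sg n by have := cycle_map_in_top j n1; rewrite inE => /andP[].
have [w []] := gen _ Oj; case/lastP: w => [//|w a] _.
rewrite -cats1 big_cat big_seq1 all_cat /= => /and3P[_ Aa _] Dj.
apply/imsetP; exists a => //; apply/eqP.
have sub : ~: [set j] \subset im a by rewrite -imj Dj im_mulr.
rewrite eqEsubset sub /=; apply/subsetP => y ay; rewrite !inE.
apply: contra (O_im_proper (subsetP sAS a Aa)) => /eqP yj.
rewrite -subTset; apply/subsetP => v _; have [->|vj] := eqVneq v j.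
  by rewrite -yj.
by apply: (subsetP sub); rewrite !inE.
Qed.

Definition constant_map y : pfun n := [ffun=> Some y].

Lemma O_params : 2 < n -> param_N' (O_sg n) = n - 1 /\ param_N (O_sg n) = n - 1.
Proof.
move=> n2; have n1 : 1 < n by lia.
have n0 : 0 < n by lia.
pose K : {set pfun n} := [set constant_map y | y : 'I_n].
have rk_const y : rk (constant_map y) <= 1.
  rewrite -(cards1 y); apply/subset_leq_card/subsetP => v /imP [x].
  by rewrite ffunE => -[<-]; rewrite inE.
have topO j : cycle_map j \in O_sg n.
  by have := cycle_map_in_top j n1; rewrite inE => /andP[].
have pK : K \proper O_sg n.
  apply/properP; split.
    apply/subsetP => _ /imsetP [y _ ->]; rewrite in_O; apply/and3P; split.
    - by apply: contraTneq (rk_const y) => ->; rewrite rk1 -ltnNge.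
    - by apply/forallP => x; rewrite ffunE.
    by apply/order_preservingP => x z a b; rewrite !ffunE => -[<-] [<-].
  exists (cycle_map (Ordinal n0)) => //.
  apply/imsetP => -[y _ D]; have := rk_const y; rewrite -D leqNgt.
  have := cycle_map_in_top (Ordinal n0) n1; rewrite inE => /andP[_].
  by move: (rk _); lia.
have KP c s : c \in K -> s \in O_sg n -> c * s \in K /\ s * c = c.
  case/imsetP=> y _ ->; rewrite in_O => /and3P[_ /forallP tot _]; split.
    case Dy: (s y) (tot y) => [v|] // _; apply/imsetP; exists v => //.
    by apply/ffunP => x; rewrite pmulE !ffunE /= Dy.
  apply/ffunP => x; rewrite pmulE !ffunE.
  by case: (s x) (tot x) => //= v _; rewrite ffunE.
have K0 : K != set0 by apply/set0Pn; exists (constant_map (Ordinal n0)); apply: imset_f.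
have S1 : 1 \notin O_sg n by rewrite in_O eqxx.
have kS := ker_eq K0 (proper_sub pK) KP.
have gA : generating (O_sg n) cycle_maps.
  apply: generating_submonoid => //.
  - by apply/set0Pn; exists (cycle_map (Ordinal n0)).
  - by apply/subsetP => _ /imsetP [j _ ->].
  exact: O_cycle_maps.
have lb A : minimal_generating (O_sg n) A -> n - 1 <= depth (O_sg n) A.
  apply: (minimal_depth_ge S1 K0 pK KP) => [_ /imsetP [y _ ->] //|s Ss].
  apply: submonoid_trans (O_cycle_maps Ss) => _ /imsetP [j _ ->].
  exact/submonoid_mem/cycle_map_in_top.
apply: (depth_params_lower lb); exists cycle_maps.
have card_cycle : #|cycle_maps| = rank (O_sg n).
  apply/eqP; rewrite eqn_leq rank_le // andbT.
  have [|B [gB <-]] := @rankP _ (O_sg n).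
    by apply/set0Pn; exists (cycle_map (Ordinal n0)).
  apply: leq_trans (O_generating_card n1 gB).
  by rewrite -[leqRHS]card_ord leq_imset_card.
split=> //; apply/eqP; rewrite eqn_leq lb ?rank_minimal // andbT.
(* The word of length n - 1 reaching a constant repeats the map x |-> x - 1. *)
have pow k : \prod_(a <- nseq k (of_nat_fun predn)) a = of_nat_fun (fun i : nat => i - k).
  elim: k => [|k IHk].
    by rewrite big_nil -of_nat_fun_id; apply: eq_of_nat_fun => i _; rewrite subn0.
  rewrite big_cons IHk of_nat_funM => [|i]; last lia.
  by apply: eq_of_nat_fun => i _; lia.
rewrite -(size_nseq (n - 1) (of_nat_fun predn)); apply: depth_le => //.
- move=> s; rewrite kS; apply: ker_not_identity pK _ => c t Kc St.
  by have [] := KP c t Kc St.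
- by rewrite kS proper_sub.
- by rewrite -size_eq0 size_nseq; lia.
- by apply/allP => a /nseqP [-> _]; apply: pred_map_in_cycle_maps.
rewrite kS pow; apply/imsetP; exists (Ordinal n0) => //; apply/ffunP => x.
rewrite !ffunE; have -> : x - (n - 1) = Ordinal n0 by have := ltn_ord x; rewrite /=; lia.
by rewrite valK.
Qed.

End PartialMaps.

Theorem proposition3p18 (n : nat) (hn : 3 <= n) :
  [/\ param_N' (PO_sg n) = n, param_N (PO_sg n) = n,
      param_M (PO_sg n) = n & param_M' (PO_sg n) = n]
  /\ (param_N' (O_sg n) = n - 1 /\ param_N (O_sg n) = n - 1)
  /\ [/\ param_N' (POI_sg n) = n, param_N (POI_sg n) = n,
         param_M (POI_sg n) = n & param_M' (POI_sg n) = n].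
Proof.
have n1 : 1 < n by exact: ltnW.
by split; [exact: PO_params | split; [exact: O_params | exact: POI_params]].
Qed.
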